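(* Let $0<p<1$, let $(\Omega,\mu)$ be a measure space, and let $x,y\in L_p(\Omega;\mathbb R)$ satisfy $x+y\ge0$ and $x-y\ge0$ almost everywhere on $\Omega$. Then $$\|x+y\|_{L_p}^2+\|x-y\|_{L_p}^2\ \le\ 2\|x\|_{L_p}^2+p\,2^{2/p-1}\|y\|_{L_p}^2 .$$ The coefficient $p\,2^{2/p-1}$ is optimal, i.e. it is the smallest constant for which this inequality holds for all measure spaces and all such $x,y$.
   Context: For $0<p<1$, $L_p(\Omega;\mathbb R)$ is the space of real measurable functions with $\|x\|_{L_p}=\left(\int_\Omega|x|^p\,d\mu\right)^{1/p}<\infty$. *)

(* Defs.v *)
From HB Require Import structures.
From mathcomp Require Import all_boot all_order all_algebra.
From mathcomp Require Import all_classical all_reals all_analysis.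

Set Implicit Arguments.
Unset Strict Implicit.
Unset Printing Implicit Defensive.
Import Order.TTheory GRing.Theory Num.Theory.

Local Open Scope classical_set_scope.
Local Open Scope ring_scope.

(* Elements of L_p are represented by functions instead of classes modulo
   a.e. equality. [Lfun mu p%:E] makes sense for every [p : R], unlike
   [LfunType], which needs [1 <= p]. Norms are kept in [\bar R], so that no
   infinite norm can be silently turned into [0] by [fine]. *)
Definition cone_ineq (R : realType) (p C : R) : Prop :=
  forall (d : measure_display) (T : measurableType d)
         (mu : {measure set T -> \bar R}) (x y : T -> R),
    x \in Lfun mu p%:E -> y \in Lfun mu p%:E ->
    {ae mu, forall t, 0 <= x t + y t} ->
    {ae mu, forall t, 0 <= x t - y t} ->
    ('N[mu]_p%:E[EFin \o (x \+ y)%R] ^+ 2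
       + 'N[mu]_p%:E[EFin \o (x \- y)%R] ^+ 2
     <= 2%:E * 'N[mu]_p%:E[EFin \o x] ^+ 2
       + C%:E * 'N[mu]_p%:E[EFin \o y] ^+ 2)%E.

(* Main.v *)
Require Import Defs.
From HB Require Import structures.
From mathcomp Require Import all_boot all_order all_algebra.
From mathcomp Require Import all_classical all_reals all_analysis.
From mathcomp Require Import measurable_realfun ring lra.

Import Order.TTheory GRing.Theory Num.Theory.
Import numFieldNormedType.Exports.
Local Open Scope classical_set_scope.
Local Open Scope ring_scope.

(** The inequality follows from a bound on the second derivative of the squared
    quasi-norm along a segment.  After a modification on a null set, [|y| <= x]
    holds everywhere, so [x + t y >= 0] for [|t| <= 1], and with
    [S(t) = \int (x + t y)^p] the function [phi(t) = S(t)^(2/p)] equals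
    [N(x + t y)^2].  The claim reads
    [phi(1) + phi(-1) - 2 phi(0) <= C N(y)^2] with [C = p 2^(2/p-1)], and it
    follows from [phi'' <= C N(y)^2] on the open interval [(-1, 1)]
    ([second_difference_le]).

    Differentiation under the integral sign ([is_derive_moment]) gives
      [phi'' = 2 (2-p) S^(2/p-2) K^2 - 2 (1-p) S^(2/p-1) Q]
    where [K = \int (x + t y)^(p-1) y] and [Q = \int (x + t y)^(p-2) y^2].
    Pointwise, [(x + t y)^(p-1) |y|] is a geometric mean of [|y|^p] and
    [(x + t y)^(p-2) y^2], with weights [1/(2-p)] and [(1-p)/(2-p)].  Hoelder's
    inequality therefore bounds [|K|] by the same mean of [L = \int |y|^p] and
    [Q] ([norm_moment1_le]), and what is left is a weighted
    arithmetic-geometric mean inequality between [S^(2/p-1) Q] and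
    [2^(2/p-1) L^(2/p)] ([hessian_le]), which is where the constant arises.

    The derivatives blow up at [t = 1] and [t = -1] where [x + t y] may vanish,
    so the second difference is first taken at [r < 1]; the passage to [r = 1]
    needs no continuity, because [x + r y >= r (x + y)] implies
    [r^2 phi(1) <= phi(r)], and likewise at [-1].

    Equality in Hoelder and in the mean inequality forces [|y|] to be
    proportional to [x] on its support, and half of [S] to sit on that support.
    Hence two atoms of mass [1], with [x = (1, 1)] and [y = (h, 0)], give
    [phi''(0) = C N(y)^2] exactly; dividing by [h^2] and letting [h] tend to [0]
    shows that no smaller constant works ([cone_ineq_ge]). *)

(** * Second differences and second derivatives *)

(** By the mean value theorem, [g(t) = F(t) + F(-t) - M t^2] has derivative
    [dF(t) - dF(-t) - 2 M t = 2 t (ddF(e) - M) <= 0] for [t >= 0]. *)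
Lemma second_difference_le (R : realType) (F dF ddF : R -> R) (r M : R) :
  (forall t : R, `|t| < r -> is_derive t 1 F (dF t)) ->
  (forall t : R, `|t| < r -> is_derive t 1 dF (ddF t)) ->
  (forall t : R, `|t| < r -> ddF t <= M) ->
  forall h : R, 0 <= h < r -> F h + F (- h) - 2 * F 0 <= M * h ^+ 2.
Proof.
move=> F' F'' ddFM h /andP[]; rewrite le_eqVlt => /predU1P[<- _|h0 hr].
  by rewrite oppr0 expr0n/=; lra.
have within_cont (f df : R -> R) (a b : R) : - r < a -> b < r ->
    (forall t : R, `|t| < r -> is_derive t 1 f (df t)) ->
    {within `[a, b], continuous f}.
  move=> ra br f'; apply: derivable_within_continuous => t.
  rewrite in_itv/= => /andP[at_ tb].
  by have := f' t; rewrite ltr_norml => /(_ ltac:(lra)) [].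
pose g (t : R) := F t + F (- t) - M * t ^+ 2.
pose dg (t : R) := dF t - dF (- t) - M * (2 * t).
have g' (t : R) : `|t| < r -> is_derive t 1 g (dg t).
  move=> tr.
  have F't := F' _ tr.
  have F'Nt : is_derive (- t) 1 F (dF (- t)) by apply: F'; rewrite normrN.
  have FN : is_derive t 1 (F \o -%R) (dF (- t) * -1).
    by apply: is_derive1_comp.
  rewrite /g /dg; apply: is_derive_eq.
  rewrite /GRing.scale/= ?expr1; ring.
have [c c0h gh] : exists2 c, c \in `]0, h[ & g h - g 0 = dg c * (h - 0).
  apply: MVT => //; last by apply: within_cont g' => //; lra.
  by move=> t; rewrite in_itv/= => th; apply: g'; rewrite ltr_norml; lra.
move: c0h; rewrite in_itv/= => /andP[c0 ch].
have [e] : exists2 e, e \in `](- c), c[ & dF c - dF (- c) = ddF e * (c - - c).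
  apply: MVT; [lra| |by apply: within_cont F'' => //; lra].
  by move=> t; rewrite in_itv/= => th; apply: F''; rewrite ltr_norml; lra.
rewrite in_itv/= => ec dFc.
have ddFe : ddF e <= M by apply: ddFM; rewrite ltr_norml; lra.
have dgc : dg c <= 0 by rewrite /dg; nra.
have : g h - g 0 <= 0 by rewrite gh subr0 mulr_le0_ge0// ltW.
by rewrite /g oppr0 expr0n/=; lra.
Qed.

Lemma second_difference_ge (R : realType) (F dF ddF : R -> R) (r M : R) :
  (forall t : R, `|t| < r -> is_derive t 1 F (dF t)) ->
  (forall t : R, `|t| < r -> is_derive t 1 dF (ddF t)) ->
  (forall t : R, `|t| < r -> M <= ddF t) ->
  forall h : R, 0 <= h < r -> M * h ^+ 2 <= F h + F (- h) - 2 * F 0.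
Proof.
move=> F' F'' Mdd h hr.
have := @second_difference_le R (- F) (- dF) (- ddF) r (- M).
move=> /(_ _ _ _ h hr); rewrite !fctE => H.
suff : - F h - F (- h) - 2 * - F 0 <= - M * h ^+ 2 by lra.
apply: H => t tr.
- by have := F' t tr; exact: is_deriveN.
- by have := F'' t tr; exact: is_deriveN.
- by rewrite lerN2 Mdd.
Qed.

(** * The scalar inequality that produces the constant *)

Lemma powR_amgm (R : realType) (a b s : R) : 0 <= a -> 0 <= b -> 0 < s < 1 ->
  a `^ s * b `^ (1 - s) <= s * a + (1 - s) * b.
Proof.
move=> a0 b0 s01.
have s0 : s != 0 by lra.
have s1 : 1 - s != 0 by lra.
have := @conjugate_powR R (a `^ s) (b `^ (1 - s)) s^-1 (1 - s)^-1.
rewrite -!powRrM !mulfV// !powRr1// !invrK (mulrC s) (mulrC (1 - s)).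
by apply; rewrite ?powR_ge0// ?invr_gt0 ?subr_gt0; lra.
Qed.

(** The left-hand side is the second derivative of [S^(2/p)] along a line, with
    [K] and [Q] the first two derivatives of [S] up to constants, and [L] the
    [p]-th power of the norm of the direction.  The bound on [K] turns the
    first term into at most [2 - p] times a geometric mean of [S^(2/p-1) Q] and
    [2^(2/p-1) L^(2/p)]; of the corresponding arithmetic mean, the first part
    cancels the negative term and the second is the right-hand side. *)
Lemma hessian_le (R : realType) (p S K Q L : R) : 0 < p < 1 ->
  0 < S -> 0 <= Q -> 0 <= L ->
  `|K| <= L `^ (2 - p)^-1 * Q `^ (1 - (2 - p)^-1) ->
  2 * (2 - p) * S `^ (2 / p - 2) * K ^+ 2 - 2 * (1 - p) * S `^ (2 / p - 1) * Q
  <= p * 2 `^ (2 / p - 1) * L `^ (2 / p).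
Proof.
move=> p01 S0 Q0 L0 KLQ.
have p0 : p != 0 by lra.
have p2 : 2 - p != 0 by lra.
(* The only weight for which the arithmetic mean, multiplied by [2 - p],
   has the coefficient [2 (1 - p)] of the negative term. *)
pose a := 2 * (1 - p) / (2 - p).
have a01 : 0 < a < 1.
  by rewrite /a ltr_pdivrMr ?divr_gt0; lra.
have K2 : K ^+ 2 <= L `^ (2 / (2 - p)) * Q `^ a.
  rewrite -real_normK ?num_real//.
  have -> : L `^ (2 / (2 - p)) * Q `^ a
      = (L `^ (2 - p)^-1 * Q `^ (1 - (2 - p)^-1)) ^+ 2.
    rewrite exprMn -!powR_mulrn ?powR_ge0// -!powRrM; congr (_ * _).
      by rewrite mulrC.
    by rewrite /a; congr (_ `^ _); field.
  by rewrite lerXn2r ?nnegrE ?mulr_ge0 ?powR_ge0.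
have := @powR_amgm R (S `^ (2 / p - 1) * Q) (2 `^ (2 / p - 1) * L `^ (2 / p)) a.
rewrite ?mulr_ge0 ?powR_ge0// => /(_ isT isT a01).
rewrite !powRM ?mulr_ge0 ?powR_ge0// -!powRrM.
have -> : (2 / p - 1) * a = 2 / p - 2 by rewrite /a; field; apply/andP.
have -> : (2 / p - 1) * (1 - a) = 1 by rewrite /a; field; apply/andP.
have -> : 2 / p * (1 - a) = 2 / (2 - p) by rewrite /a; field; apply/andP.
rewrite powRr1// => amgm.
have {}K2 : (2 - p) * (2 * (S `^ (2 / p - 2) * K ^+ 2)) <= (2 - p) *
    (a * (S `^ (2 / p - 1) * Q) + (1 - a) * (2 `^ (2 / p - 1) * L `^ (2 / p))).
  rewrite ler_pM2l; last lra.
  apply: le_trans amgm.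
  rewrite -subr_ge0 in K2.
  have := mulr_ge0 (powR_ge0 S (2 / p - 2)) K2.
  lra.
have aE X Y : (2 - p) * (a * X + (1 - a) * Y) = 2 * (1 - p) * X + p * Y.
  by rewrite /a; field.
move: K2; rewrite aE; lra.
Qed.

(** * Differentiation of the moments along a segment *)

Section line_term.
Context {R : realType} (p : R).
Hypothesis p01 : 0 < p < 1.

(** The family is closed under differentiation in [t]: the derivative of the
    [k]-th term is [p - k] times the next one, so one lemma covers all orders.
    Where [u = v = 0] every term is [0], as [p - k] never vanishes. *)
Definition line_term (k : nat) (u v t : R) : R :=
  (u + t * v) `^ (p - k%:R) * v ^+ k.

Lemma expo_neq0 k : p - k%:R != 0.
Proof.
case: k => [|k]; first by rewrite subr0; move: p01; lra.
by rewrite lt_eqF// -natr1; have := ler0n R k; move: p01; lra.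
Qed.

Lemma line_arg_ge (u v t rho : R) : `|v| <= u -> `|t| <= rho ->
  (1 - rho) * u <= u + t * v.
Proof.
move=> vu trho.
have : `|t * v| <= rho * u by rewrite normrM ler_pM.
by rewrite ler_norml; lra.
Qed.

(** A bound that is uniform in [|t| <= rho] and a multiple of [u^p] for every
    [k]: write [(u + t v)^(p-k)] as a quotient, bound its numerator by
    [(2 u)^p] and its denominator from below by [((1-rho) u)^k], and use
    [|v|^k <= u^k].  This is the dominating function in the differentiation
    under the integral sign. *)
Lemma norm_line_term_le k (u v t rho : R) : `|v| <= u -> `|t| <= rho -> rho < 1 ->
  `|line_term k u v t| <= 2 `^ p / (1 - rho) ^+ k * u `^ p.
Proof.
move=> vu trho rho1.
have p01' := p01.
have p0 : p != 0 by lra.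
have u0 : 0 <= u by exact: le_trans vu.
have [u0'|u0'] := eqVneq u 0.
  have v0 : v = 0 by apply/eqP; rewrite -normr_le0 -u0'.
  by rewrite /line_term u0' v0 mulr0 addr0 !powR0 ?expo_neq0// mul0r mulr0 normr0.
have {}u0 : 0 < u by rewrite lt_neqAle eq_sym u0'.
have le_arg := @line_arg_ge _ _ _ _ vu trho.
have ru0 : 0 < (1 - rho) * u by rewrite mulr_gt0// subr_gt0.
have arg0 : 0 < u + t * v by exact: lt_le_trans le_arg.
have arg_le : u + t * v <= 2 * u.
  have : `|t * v| <= 1 * u by rewrite normrM ler_pM// (le_trans trho)// ltW.
  by rewrite ler_norml; lra.
rewrite /line_term normrM normrX (ger0_norm (powR_ge0 _ _)).
rewrite powRB; last by rewrite (gt_eqF arg0) implybT.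
rewrite powR_mulrn ?(ltW arg0)// mulrAC -mulrA.
have -> : 2 `^ p / (1 - rho) ^+ k * u `^ p =
    (2 * u) `^ p * (u ^+ k / ((1 - rho) * u) ^+ k).
  rewrite powRM ?(ltW u0)// exprMn; field.
  by rewrite !expf_neq0 ?gt_eqF// subr_gt0.
apply: ler_pM => //.
- exact: powR_ge0.
- by rewrite divr_ge0// exprn_ge0// ltW.
- by rewrite ge0_ler_powR ?nnegrE; lra.
- apply: ler_pM => //.
  + by rewrite invr_ge0 exprn_ge0// ltW.
  + by rewrite lerXn2r ?nnegrE// (ltW u0).
  + rewrite lef_pV2 ?posrE ?exprn_gt0//.
    by rewrite lerXn2r ?nnegrE ?(ltW ru0) ?(ltW arg0).
Qed.

Lemma is_derive_line_term k (u v t : R) : `|v| <= u -> `|t| < 1 ->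
  is_derive t 1 (line_term k u v) ((p - k%:R) * line_term k.+1 u v t).
Proof.
move=> vu t1.
have u0 : 0 <= u by exact: le_trans vu.
have [u0'|u0'] := eqVneq u 0.
  have v0 : v = 0 by apply/eqP; rewrite -normr_le0 -u0'.
  rewrite (_ : line_term k u v = cst 0); last first.
    apply/funext => s.
    by rewrite /line_term u0' v0 mulr0 addr0 !powR0 ?expo_neq0// mul0r.
  rewrite /line_term u0' v0 mulr0 addr0 powR0 ?expo_neq0// mul0r mulr0.
  exact: is_derive_cst.
have {}u0 : 0 < u by rewrite lt_neqAle eq_sym u0'.
have arg0 : 0 < u + t * v.
  apply: lt_le_trans (@line_arg_ge _ _ _ _ vu (lexx _)).
  by rewrite mulr_gt0// subr_gt0.
pose arg (s : R) := u + s * v.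
have arg' : is_derive t 1 arg v.
  by apply: is_derive_eq; rewrite /GRing.scale/=; ring.
have pow' : is_derive (arg t) 1 (@powR R ^~ (p - k%:R))
    ((p - k%:R) * arg t `^ (p - k%:R - 1)) by exact: is_derive1_powR.
have comp' := is_derive1_comp pow' arg'.
have -> : line_term k u v = v ^+ k \*: ((@powR R ^~ (p - k%:R)) \o arg).
  by apply/funext => s; rewrite /line_term mulrC.
apply: is_derive_eq.
rewrite /line_term -natr1 opprD addrA exprSr /GRing.scale/=; ring.
Qed.

End line_term.

Lemma measurable_powR_fun {R : realType} {d} {T : measurableType d}
    (f : T -> R) (s : R) :
  measurable_fun setT f -> measurable_fun setT (fun z => f z `^ s).
Proof. exact: (@measurableT_comp _ _ _ _ _ _ (@powR R ^~ s)). Qed.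

Lemma integrableZl_EFin {R : realType} {d} {T : measurableType d}
    {mu : {measure set T -> \bar R}} (c : R) (f : T -> R) :
  mu.-integrable setT (EFin \o f) ->
  mu.-integrable setT (EFin \o (fun z => c * f z)).
Proof.
by rewrite /comp => fi; under eq_fun do rewrite EFinM; exact: integrableZl.
Qed.

Section moments.
Context {R : realType} (p : R) d (T : measurableType d).
Context (mu : {measure set T -> \bar R}) (x y : T -> R).
Hypotheses (p01 : 0 < p < 1).
Hypotheses (mx : measurable_fun setT x) (my : measurable_fun setT y).
Hypothesis yx : forall z, `|y z| <= x z.
Hypothesis intx : mu.-integrable setT (fun z => (x z `^ p)%:E).

Definition moment (k : nat) (t : R) : R := \int[mu]_z line_term p k (x z) (y z) t.

Lemma measurable_line_term k t :
  measurable_fun setT (fun z => line_term p k (x z) (y z) t).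
Proof.
apply: measurable_funM; last exact: measurable_funX.
apply: measurable_powR_fun; apply: measurable_funD => //.
exact: measurable_funM.
Qed.

Lemma integrable_line_term k t : `|t| < 1 ->
  mu.-integrable setT (fun z => (line_term p k (x z) (y z) t)%:E).
Proof.
move=> t1.
apply: (le_integrable measurableT (g := fun z =>
  ((2 `^ p / (1 - `|t|) ^+ k)%:E * (x z `^ p)%:E)%E)).
- exact/measurable_EFinP/measurable_line_term.
- move=> z _ /=; rewrite lee_fin.
  by apply: le_trans (ler_norm _); exact: norm_line_term_le.
- exact: integrableZl.
Qed.

Lemma is_derive_moment k (t : R) : `|t| < 1 ->
  is_derive t 1 (moment k) ((p - k%:R) * moment k.+1 t).
Proof.
move=> t1.
(* Strictly between [|t|] and [1]: the domination needs a margin at [1]. *)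
pose rho := (1 + `|t|) / 2.
have rho1 : rho < 1 by rewrite /rho; lra.
have trho : `]- rho, rho[%classic t.
  by rewrite /= in_itv/= -ltr_norml /rho; lra.
have small s : `]- rho, rho[%classic s -> `|s| < rho.
  by rewrite /= in_itv/= ltr_norml.
pose f (s : R) z := line_term p k (x z) (y z) s.
have f' (s : R) z : `|s| < 1 ->
    is_derive s 1 (f ^~ z) ((p - k%:R) * line_term p k.+1 (x z) (y z) s).
  by move=> s1; exact: is_derive_line_term.
pose G z := `|p - k%:R| * (2 `^ p / (1 - rho) ^+ k.+1) * x z `^ p.
have intf s : `]- rho, rho[%classic s -> mu.-integrable setT (EFin \o f s).
  by move=> /small srho; apply: integrable_line_term; exact: lt_trans rho1.
have derf (s : R) z : `]- rho, rho[%classic s -> [set: T] z -> derivable (f ^~ z) s 1.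
  by move=> /small srho _; have [] := f' s z (lt_trans srho rho1).
have d1f s z : `|s| < 1 ->
    partial1of2 f s z = (p - k%:R) * line_term p k.+1 (x z) (y z) s.
  by move=> s1; rewrite partial1of2E; have := f' s z s1; case.
have G0 z : 0 <= G z.
  rewrite /G !mulr_ge0 ?powR_ge0// invr_ge0 exprn_ge0//; lra.
have intG : mu.-integrable setT (EFin \o G).
  rewrite /G /comp; under eq_fun do rewrite EFinM.
  exact: integrableZl.
have Gub s z : `]- rho, rho[%classic s -> [set: T] z ->
    `|partial1of2 f s z| <= G z.
  move=> /small srho _; rewrite d1f ?(lt_trans srho)//.
  rewrite normrM /G -mulrA ler_wpM2l//.
  by apply: norm_line_term_le => //; exact: ltW.
apply: DeriveDef.
  exact: (derivable_under_integral measurableT trho intf derf G0 intG Gub).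
rewrite -derive1E.
rewrite (differentiation_under_integral measurableT trho intf derf G0 intG Gub).
rewrite -RintegralZl//; last exact: integrable_line_term.
by apply: eq_Rintegral => z _; exact: d1f.
Qed.

End moments.

(** * The inequality for functions dominated everywhere *)

Lemma Rintegral_hoelder {R : realType} d (T : measurableType d)
    (mu : {measure set T -> \bar R}) (u v : T -> R) (s : R) : 0 < s < 1 ->
  (forall z, 0 <= u z) -> (forall z, 0 <= v z) ->
  mu.-integrable setT (EFin \o u) -> mu.-integrable setT (EFin \o v) ->
  \int[mu]_z (u z `^ s * v z `^ (1 - s))
    <= (\int[mu]_z u z) `^ s * (\int[mu]_z v z) `^ (1 - s).
Proof.
move=> s01 u0 v0 iu iv.
have mu_ : measurable_fun setT u by move/measurable_int/measurable_EFinP : iu.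
have mv_ : measurable_fun setT v by move/measurable_int/measurable_EFinP : iv.
have Lnorm_powR (f : T -> R) (a : R) : 0 < a -> (forall z, 0 <= f z) ->
    mu.-integrable setT (EFin \o f) ->
    ('N[mu]_(a^-1)%:E[EFin \o (fun z => f z `^ a)%R]
      = ((\int[mu]_z f z) `^ a)%:E)%E.
  move=> a0 f0 fi; rewrite unlock invrK -poweR_EFin /Rintegral fineK.
    congr (_ `^ _)%E; apply: eq_integral => z _ /=.
    by rewrite ger0_norm ?powR_ge0// -powRrM mulfV ?gt_eqF// powRr1.
  exact: integrable_fin_num.
have : ('N[mu]_1[EFin \o ((fun z => u z `^ s) \* (fun z => v z `^ (1 - s)))%R]
    <= ((\int[mu]_z u z) `^ s * (\int[mu]_z v z) `^ (1 - s))%:E)%E.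
  have [s0 s1] : 0 < s /\ 0 < 1 - s by lra.
  rewrite EFinM -(Lnorm_powR u s s0 u0 iu) -(Lnorm_powR v _ s1 v0 iv).
  apply: hoelder; rewrite ?invr_gt0 ?invrK; [| |lra|lra|lra];
    exact: measurable_powR_fun.
rewrite Lnorm1.
have -> : (\int[mu]_z `|(EFin \o
      ((fun z => u z `^ s) \* (fun z => v z `^ (1 - s)))%R) z|
    = \int[mu]_z (u z `^ s * v z `^ (1 - s))%:E)%E.
  apply: eq_integral => z _ /=.
  by rewrite ger0_norm// mulr_ge0 ?powR_ge0.
move=> le_int; rewrite -lee_fin /Rintegral fineK//.
rewrite ge0_fin_numE; first exact: le_lt_trans le_int (ltry _).
by apply: integral_ge0 => z _; rewrite lee_fin mulr_ge0 ?powR_ge0.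
Qed.

Lemma le_of_sqr_scaled {R : realFieldType} (a b : R) :
  (forall r, 0 <= r < 1 -> r ^+ 2 * a <= b) -> a <= b.
Proof.
move=> le_r; rewrite leNgt; apply/negP => ltba.
have b0 : 0 <= b by have := le_r 0; rewrite expr0n/= mul0r lexx ltr01; exact.
have a0 : 0 < a by exact: le_lt_trans ltba.
pose r := b / a.
have r0 : 0 <= r by rewrite divr_ge0// ltW.
have r1 : r < 1 by rewrite ltr_pdivrMr// mul1r.
have /le_r : 0 <= (1 + r) / 2 < 1 by lra.
have -> : b = r * a by rewrite /r divfK// gt_eqF.
by rewrite ler_pM2r//; nra.
Qed.

(** Replaces continuity of [f] at the end points by the scaling bounds
    [r^2 A <= f(r)] and [r^2 B <= f(-r)]. *)
Lemma le_of_scaled_second_difference {R : realFieldType} (f : R -> R)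
    (A B M : R) : 0 <= M ->
  (forall r, 0 <= r < 1 -> f r + f (- r) - 2 * f 0 <= M * r ^+ 2) ->
  (forall r, 0 <= r < 1 -> r ^+ 2 * A <= f r) ->
  (forall r, 0 <= r < 1 -> r ^+ 2 * B <= f (- r)) ->
  A + B <= 2 * f 0 + M.
Proof.
move=> M0 f_le fA fB; apply: le_of_sqr_scaled => r r01; rewrite mulrDr.
have r2 : M * r ^+ 2 <= M by rewrite ler_piMr// expr_le1//; lra.
by have := fA r r01; have := fB r r01; have := f_le r r01; lra.
Qed.

Lemma sqr_mul_powR_le {R : realType} (p r I J : R) : 0 < p -> 0 <= r ->
  0 <= I -> r `^ p * I <= J -> r ^+ 2 * I `^ (2 / p) <= J `^ (2 / p).
Proof.
move=> p0 r0 I0 rIJ.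
have -> : r ^+ 2 = (r `^ p) `^ (2 / p).
  rewrite -powRrM -powR_mulrn//.
  by congr (_ `^ _); field; rewrite gt_eqF.
rewrite -powRM ?powR_ge0// ge0_ler_powR ?divr_ge0// ?nnegrE.
- exact: ltW.
- by rewrite mulr_ge0 ?powR_ge0.
- by apply: le_trans rIJ; rewrite mulr_ge0 ?powR_ge0.
Qed.

Section cone.
Context {R : realType} (p : R) d (T : measurableType d).
Context (mu : {measure set T -> \bar R}) (x y : T -> R).
Hypotheses (p01 : 0 < p < 1).
Hypotheses (mx : measurable_fun setT x) (my : measurable_fun setT y).
Hypothesis yx : forall z, `|y z| <= x z.
Hypothesis intx : mu.-integrable setT (fun z => (x z `^ p)%:E).

Local Notation moment := (moment p d T mu x y).

Lemma dominating_ge0 z : 0 <= x z. Proof. exact: le_trans (yx z). Qed.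

Lemma integrable_powR_le (f : T -> R) (c : R) : 0 <= c ->
  measurable_fun setT f -> (forall z, 0 <= f z <= c * x z) ->
  mu.-integrable setT (fun z => (f z `^ p)%:E).
Proof.
move=> c0 mf fx.
apply: (le_integrable measurableT (g := fun z =>
  ((c `^ p)%:E * (x z `^ p)%:E)%E)).
- exact/measurable_EFinP/measurable_powR_fun.
- move=> z _ /=; rewrite lee_fin !ger0_norm ?mulr_ge0 ?powR_ge0//.
  have /andP[f0 fc] := fx z.
  rewrite -powRM ?dominating_ge0// ge0_ler_powR ?nnegrE ?mulr_ge0 ?dominating_ge0//.
  by move/andP: p01 => [/ltW].
- exact: integrableZl.
Qed.

Lemma moment0E t : moment 0 t = \int[mu]_z (x z + t * y z) `^ p.
Proof.
by apply: eq_Rintegral => z _; rewrite /line_term subr0 expr0 mulr1.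
Qed.

Lemma integrable_powR_line_term t : `|t| <= 1 ->
  mu.-integrable setT (fun z => ((x z + t * y z) `^ p)%:E).
Proof.
move=> t1; apply: (@integrable_powR_le _ 2) => //.
  by apply: measurable_funD => //; exact: measurable_funM.
move=> z; have : `|t * y z| <= 1 * x z by rewrite normrM ler_pM.
by rewrite ler_norml; lra.
Qed.

Lemma integrable_powR_y : mu.-integrable setT (fun z => (`|y z| `^ p)%:E).
Proof.
apply: (@integrable_powR_le _ 1) => //; first exact: measurableT_comp.
by move=> z; rewrite mul1r normr_ge0/=.
Qed.

(** The exponents match: those of [|y|] add up to
    [p/(2-p) + 2 (1-p)/(2-p) = 1] and those of [x + t y] to
    [(p-2) (1-p)/(2-p) = p-1]. *)
Lemma norm_line_term1 z (t : R) : `|t| < 1 ->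
  `|line_term p 1 (x z) (y z) t| =
  (`|y z| `^ p) `^ (2 - p)^-1 * line_term p 2 (x z) (y z) t `^ (1 - (2 - p)^-1).
Proof.
move=> t1; have p01' := p01.
have p2 : 2 - p != 0 by lra.
have [y0|y0] := eqVneq (y z) 0.
  rewrite /line_term y0 normr0 !expr0n/= !mulr0 normr0 powR0; last lra.
  by rewrite powR0 ?mul0r// invr_neq0.
have x0 : 0 < x z by apply: lt_le_trans (yx z); rewrite normr_gt0.
have arg0 : 0 < x z + t * y z.
  apply: lt_le_trans (line_arg_ge _ _ _ _ (yx z) (lexx _)).
  by rewrite mulr_gt0// subr_gt0.
rewrite /line_term normrM (ger0_norm (powR_ge0 _ _)) expr1.
rewrite -(real_normK (num_real (y z))) -powR_mulrn//.
rewrite powRM ?powR_ge0// -!powRrM mulrCA -powRD; last first.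
  by rewrite normr_eq0 y0 implybT.
have -> : p / (2 - p) + 2 * (1 - (2 - p)^-1) = 1 by field.
have -> : (p - 2) * (1 - (2 - p)^-1) = p - 1 by field.
by rewrite powRr1.
Qed.

Lemma moment2_ge0 t : 0 <= moment 2 t.
Proof.
apply: Rintegral_ge0 => z _.
by rewrite /line_term mulr_ge0 ?powR_ge0// sqr_ge0.
Qed.

Lemma norm_moment1_le t : `|t| < 1 ->
  `|moment 1 t| <= (\int[mu]_z `|y z| `^ p) `^ (2 - p)^-1 *
                   moment 2 t `^ (1 - (2 - p)^-1).
Proof.
move=> t1; have p01' := p01.
have int2 := integrable_line_term p d T mu x y p01 mx my yx intx 2 t t1.
have int1 := integrable_line_term p d T mu x y p01 mx my yx intx 1 t t1.
apply: le_trans (le_normr_Rintegral measurableT int1) _.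
under eq_Rintegral do rewrite norm_line_term1//.
apply: Rintegral_hoelder => //.
- by rewrite invr_gt0 invf_lt1; lra.
- by move=> z; rewrite /line_term mulr_ge0 ?powR_ge0// sqr_ge0.
- exact: integrable_powR_y.
Qed.

(** Since [x >= 0], one has [x + r e y >= r (x + e y)]. *)
Lemma moment0_ge_scaled (e r : R) : `|e| = 1 -> 0 <= r < 1 ->
  r `^ p * (\int[mu]_z (x z + e * y z) `^ p) <= moment 0 (r * e).
Proof.
move=> e1 r01.
have e1' : `|e| <= 1 by rewrite e1.
have ie := integrable_powR_line_term e e1'.
rewrite -RintegralZl// moment0E; apply: le_Rintegral => //.
- exact: integrableZl_EFin.
- apply: integrable_powR_line_term.
  by rewrite normrM e1 mulr1 ger0_norm; lra.
- move=> z _; have p01' := p01.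
  have ey : - x z <= e * y z.
    have : `|e * y z| <= x z by rewrite normrM e1 mul1r.
    by rewrite ler_norml => /andP[].
  have x0 := dominating_ge0 z.
  by rewrite -powRM; [apply: ge0_ler_powR|..]; rewrite ?nnegrE; nra.
Qed.

Hypothesis x_gt0 : 0 < \int[mu]_z x z `^ p.

Lemma moment0_gt0 t : `|t| < 1 -> 0 < moment 0 t.
Proof.
move=> t1; have p01' := p01.
apply: (@lt_le_trans _ _ ((1 - `|t|) `^ p * \int[mu]_z x z `^ p)).
  by rewrite mulr_gt0// powR_gt0// subr_gt0.
rewrite -RintegralZl// moment0E; apply: le_Rintegral => //.
- exact: integrableZl_EFin.
- by apply: integrable_powR_line_term; exact: ltW.
- move=> z _; have le_arg := line_arg_ge _ _ _ _ (yx z) (lexx `|t|).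
  have t1' : 0 <= 1 - `|t| by lra.
  rewrite -powRM ?dominating_ge0//.
  rewrite ge0_ler_powR ?nnegrE ?mulr_ge0 ?dominating_ge0//; first lra.
  by apply: le_trans le_arg; rewrite mulr_ge0 ?dominating_ge0.
Qed.

Let phi (t : R) := moment 0 t `^ (2 / p).
Let dphi (t : R) := 2 * moment 0 t `^ (2 / p - 1) * moment 1 t.
Let ddphi (t : R) :=
  2 * (2 - p) * moment 0 t `^ (2 / p - 2) * moment 1 t ^+ 2
  - 2 * (1 - p) * moment 0 t `^ (2 / p - 1) * moment 2 t.

Lemma is_derive_moment_powR a (t : R) : `|t| < 1 ->
  is_derive t 1 (fun s : R => moment 0 s `^ a)
    (a * moment 0 t `^ (a - 1) * (p * moment 1 t)).
Proof.
move=> t1.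
have S' := is_derive_moment p d T mu x y p01 mx my yx intx 0 t t1.
have pow' : is_derive (moment 0 t) 1 (@powR R ^~ a)
    (a * moment 0 t `^ (a - 1)).
  by apply: is_derive1_powR; exact: moment0_gt0.
by have := is_derive1_comp pow' S'; rewrite subr0.
Qed.

Lemma is_derive_phi (t : R) : `|t| < 1 -> is_derive t 1 phi (dphi t).
Proof.
move=> t1; have phi' := is_derive_moment_powR (2 / p) t t1.
apply: is_derive_eq; rewrite /dphi; field.
by have p01' := p01; lra.
Qed.

Lemma is_derive_dphi (t : R) : `|t| < 1 -> is_derive t 1 dphi (ddphi t).
Proof.
move=> t1; have phi' := is_derive_moment_powR (2 / p - 1) t t1.
have K' := is_derive_moment p d T mu x y p01 mx my yx intx 1 t t1.
apply: is_derive_eq; rewrite /ddphi /GRing.scale/=.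
have -> : 2 / p - 1 - 1 = 2 / p - 2 by ring.
field.
by have p01' := p01; lra.
Qed.

Lemma phi0E : phi 0 = (\int[mu]_z x z `^ p) `^ (2 / p).
Proof.
have -> : \int[mu]_z x z `^ p = moment 0 0.
  rewrite moment0E.
  by apply: eq_Rintegral => z _; rewrite mul0r addr0.
by [].
Qed.

Lemma phi_ge_scaled (e r : R) : `|e| = 1 -> 0 <= r < 1 ->
  r ^+ 2 * (\int[mu]_z (x z + e * y z) `^ p) `^ (2 / p) <= phi (r * e).
Proof.
move=> e1 /[dup] r01 /andP[r0 _]; apply: sqr_mul_powR_le.
- by have /andP[] := p01.
- exact: r0.
- by apply: Rintegral_ge0 => z _; exact: powR_ge0.
- exact: moment0_ge_scaled.
Qed.

Lemma ddphi_le (t : R) : `|t| < 1 ->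
  ddphi t <= p * 2 `^ (2 / p - 1) * (\int[mu]_z `|y z| `^ p) `^ (2 / p).
Proof.
move=> t1; apply: hessian_le.
- exact: p01.
- exact: moment0_gt0.
- exact: moment2_ge0.
- by apply: Rintegral_ge0 => z _; exact: powR_ge0.
- exact: norm_moment1_le.
Qed.

Lemma cone_ineq_of_gt0 :
  (\int[mu]_z (x z + y z) `^ p) `^ (2 / p)
    + (\int[mu]_z (x z - y z) `^ p) `^ (2 / p)
  <= 2 * (\int[mu]_z x z `^ p) `^ (2 / p)
    + p * 2 `^ (2 / p - 1) * (\int[mu]_z `|y z| `^ p) `^ (2 / p).
Proof.
have M0 : 0 <= p * 2 `^ (2 / p - 1) * (\int[mu]_z `|y z| `^ p) `^ (2 / p).
  rewrite mulr_ge0 ?powR_ge0// mulr_ge0 ?powR_ge0//.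
  by have /andP[/ltW] := p01.
apply: (@le_trans _ _ (2 * phi 0 + _)); last by rewrite phi0E.
apply: le_of_scaled_second_difference.
- exact: M0.
- exact: (second_difference_le _ _ _ _ _ _ is_derive_phi is_derive_dphi
    ddphi_le).
- move=> r r01; have := phi_ge_scaled 1 r (normr1 _) r01; rewrite mulr1.
  by under eq_Rintegral do rewrite mul1r.
- move=> r r01; have := phi_ge_scaled (- 1) r (normrN1 _) r01; rewrite mulrN1.
  by under eq_Rintegral do rewrite mulN1r.
Qed.

End cone.

Lemma cone_ineq_Rintegral {R : realType} (p : R) d (T : measurableType d)
    (mu : {measure set T -> \bar R}) (x y : T -> R) : 0 < p < 1 ->
  measurable_fun setT x -> measurable_fun setT y ->
  (forall z, `|y z| <= x z) ->
  mu.-integrable setT (fun z => (x z `^ p)%:E) ->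
  (\int[mu]_z (x z + y z) `^ p) `^ (2 / p)
    + (\int[mu]_z (x z - y z) `^ p) `^ (2 / p)
  <= 2 * (\int[mu]_z x z `^ p) `^ (2 / p)
    + p * 2 `^ (2 / p - 1) * (\int[mu]_z `|y z| `^ p) `^ (2 / p).
Proof.
move=> p01 mx my yx intx.
(* [S(t)] is differentiated through a power, hence the case [S(0) = 0] is apart:
   there both norms on the left vanish. *)
have [x0|x_neq0] := eqVneq (\int[mu]_z x z `^ p) 0; last first.
  apply: cone_ineq_of_gt0 => //; rewrite lt_neqAle eq_sym x_neq0.
  by apply: Rintegral_ge0 => z _; exact: powR_ge0.
have q0 : 2 / p != 0 by rewrite mulf_neq0// invr_neq0//; lra.
have int0 (e : R) : `|e| <= 1 -> \int[mu]_z (x z + e * y z) `^ p = 0.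
  move=> e1; apply/eqP; rewrite eq_le; apply/andP; split; last first.
    by apply: Rintegral_ge0 => z _; exact: powR_ge0.
  have -> : 0 = 2 `^ p * \int[mu]_z x z `^ p by rewrite x0 mulr0.
  rewrite -RintegralZl//; apply: le_Rintegral => //.
  - exact: integrable_powR_line_term.
  - exact: integrableZl_EFin.
  - move=> z _; have : `|e * y z| <= 1 * x z by rewrite normrM ler_pM.
    rewrite ler_norml => ey; have xz := dominating_ge0 _ _ _ _ yx z.
    by rewrite -powRM//; apply: ge0_ler_powR; rewrite ?nnegrE; lra.
have := int0 1; rewrite normr1 lexx => /(_ isT).
under eq_Rintegral do rewrite mul1r.
move=> ->.
have := int0 (- 1); rewrite normrN1 lexx => /(_ isT).
under eq_Rintegral do rewrite mulN1r.
move=> ->.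
rewrite x0 powR0// mulr0 !add0r mulr_ge0 ?powR_ge0// mulr_ge0 ?powR_ge0//.
by have /andP[/ltW] := p01.
Qed.

(** * From quasi-norms to integrals *)

Lemma Lfun_integrable_powR {R : realType} d (T : measurableType d)
    (mu : {measure set T -> \bar R}) (p : R) (f : T -> R) : p != 0 ->
  f \in Lfun mu p%:E -> mu.-integrable setT (fun z => (`|f z| `^ p)%:E).
Proof.
move=> p0; rewrite inE => /andP[/[!inE]/= mf fp]; apply/integrableP; split.
  apply/measurable_EFinP/measurable_powR_fun.
  exact: measurableT_comp.
move: fp => /(poweR_lty p); rewrite powR_Lnorm//; apply: le_lt_trans.
by under eq_integral do rewrite gee0_abs ?lee_fin ?powR_ge0//.
Qed.

Lemma sqr_Lnorm {R : realType} d (T : measurableType d)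
    (mu : {measure set T -> \bar R}) (p : R) (f : T -> R) :
  mu.-integrable setT (fun z => (`|f z| `^ p)%:E) ->
  ('N[mu]_p%:E[EFin \o f] ^+ 2)%E
    = ((\int[mu]_z `|f z| `^ p) `^ (2 / p))%:E.
Proof.
move=> fi; rewrite unlock.
have -> : (\int[mu]_z `|(EFin \o f) z| `^ p)%E = (\int[mu]_z `|f z| `^ p)%:E.
  by rewrite /Rintegral fineK//; exact: integrable_fin_num.
by rewrite poweR_EFin -EFin_expe -powR_mulrn ?powR_ge0// -powRrM mulrC.
Qed.

Lemma ae_eq_Lnorm {R : realType} d (T : measurableType d)
    (mu : {measure set T -> \bar R}) (p : R) (f g : T -> R) :
  measurable_fun setT f -> measurable_fun setT g ->
  {ae mu, forall z, f z = g z} ->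
  'N[mu]_p%:E[EFin \o f]%E = 'N[mu]_p%:E[EFin \o g]%E.
Proof.
have mp (h : T -> R) : measurable_fun setT h ->
    measurable_fun setT (fun z => (`|h z| `^ p)%:E).
  move=> mh; apply/measurable_EFinP/measurable_powR_fun.
  exact: measurableT_comp.
move=> mf mg fg; rewrite unlock; apply: (congr1 (fun a => a `^ p^-1)%E).
apply: ae_eq_integral; [exact: measurableT|exact: mp|exact: mp|].
by apply: filterS fg => z /= -> _.
Qed.

Lemma cone_ineq_holds {R : realType} (p : R) : 0 < p < 1 ->
  cone_ineq p (p * 2 `^ (2 / p - 1)).
Proof.
move=> p01 d T mu x y xL yL xy_ge0 xNy_ge0.
have p0 : p != 0 by lra.
have mx : measurable_fun setT x by move/sub_Lfun_mfun : xL; rewrite inE.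
have my : measurable_fun setT y by move/sub_Lfun_mfun : yL; rewrite inE.
pose dom z := `|y z| <= x z.
have mdom : measurable_fun setT dom.
  by apply: measurable_fun_ler => //; exact: measurableT_comp.
(* Equal to [x] and [y] off a null set, and dominated everywhere. *)
pose x' z := if dom z then x z else 0.
pose y' z := if dom z then y z else 0.
have mx' : measurable_fun setT x' by exact: measurable_fun_ifT.
have my' : measurable_fun setT y' by exact: measurable_fun_ifT.
have ae_dom : {ae mu, forall z, dom z}.
  by apply: filterS2 xy_ge0 xNy_ge0 => z; rewrite /dom ler_norml; lra.
have y'x' z : `|y' z| <= x' z.
  by rewrite /y' /x'; case: ifPn => //; rewrite normr0.
have x'E : {ae mu, forall z, x z = x' z}.
  by apply: filterS ae_dom => z; rewrite /x' => ->.
have y'E : {ae mu, forall z, y z = y' z}.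
  by apply: filterS ae_dom => z; rewrite /y' => ->.
rewrite (@ae_eq_Lnorm _ _ _ mu p x x')// (@ae_eq_Lnorm _ _ _ mu p y y')//.
rewrite (@ae_eq_Lnorm _ _ _ mu p (x \+ y) (x' \+ y')); first last.
- by apply: filterS2 x'E y'E => z /= -> ->.
- exact: measurable_funD.
- exact: measurable_funD.
rewrite (@ae_eq_Lnorm _ _ _ mu p (x \- y) (x' \- y')); first last.
- by apply: filterS2 x'E y'E => z /= -> ->.
- exact: measurable_funB.
- exact: measurable_funB.
have x'0 z : 0 <= x' z by exact: le_trans (y'x' z).
have intx' : mu.-integrable setT (fun z => (x' z `^ p)%:E).
  apply: (le_integrable measurableT _ _ (Lfun_integrable_powR _ _ _ _ _ p0 xL)).
    exact/measurable_EFinP/measurable_powR_fun.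
  move=> z _ /=; rewrite lee_fin !(ger0_norm (powR_ge0 _ _)) /x'.
  case: ifPn => [xz|_]; last by rewrite powR0// powR_ge0.
  by rewrite ger0_norm// (le_trans _ xz).
have norm_add z : `|(x' \+ y') z| = x' z + y' z.
  by rewrite ger0_norm//=; have := y'x' z; rewrite ler_norml; lra.
have norm_sub z : `|(x' \- y') z| = x' z - y' z.
  by rewrite ger0_norm//=; have := y'x' z; rewrite ler_norml; lra.
have int_e (e : R) : `|e| <= 1 ->
    mu.-integrable setT (fun z => ((x' z + e * y' z) `^ p)%:E).
  exact: integrable_powR_line_term.
rewrite !sqr_Lnorm; first last.
- under eq_fun do rewrite norm_add -[y' _]mul1r.
  by apply: int_e; rewrite normr1.
- under eq_fun do rewrite norm_sub -[- y' _]mulN1r.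
  by apply: int_e; rewrite normrN1.
- by under eq_fun do rewrite ger0_norm//.
- exact: (integrable_powR_y _ _ _ _ x').
under eq_Rintegral do rewrite norm_add.
under [X in (_ + (X `^ _)%:E <= _)%E]eq_Rintegral do rewrite norm_sub.
under [X in (_ <= _ * (X `^ _)%:E + _)%E]eq_Rintegral do rewrite ger0_norm//.
rewrite -!EFinM -!EFinD lee_fin.
exact: cone_ineq_Rintegral.
Qed.

(** * Optimality of the constant on a two-point space *)

Definition two_points {R : realType} : {measure set bool -> \bar R} :=
  measure_add (\d_true) (\d_false).

Lemma Lnorm_two_points {R : realType} (p : R) (f : bool -> R) :
  'N[two_points]_p%:E[EFin \o f]%E =
  ((`|f true| `^ p + `|f false| `^ p) `^ p^-1)%:E.
Proof.
rewrite unlock ge0_integral_measure_add//; last by move=> b _; exact: poweR_ge0.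
by rewrite !integral_dirac// !diracT !mul1e.
Qed.

Lemma sqr_Lnorm_two_points {R : realType} (p : R) (f : bool -> R) :
  ('N[two_points]_p%:E[EFin \o f] ^+ 2)%E =
  ((`|f true| `^ p + `|f false| `^ p) `^ (2 / p))%:E.
Proof.
rewrite Lnorm_two_points -EFin_expe -powR_mulrn ?powR_ge0// -powRrM.
by rewrite mulrC.
Qed.

Section optimality.
Context {R : realType} (p : R).
Hypothesis p01 : 0 < p < 1.

(* The squared norm of [x + t y] for [x = (1, 1)] and [y = (1, 0)]. *)
Let psi (t : R) := ((1 + t) `^ p + 1) `^ (2 / p).
Let dpsi (t : R) := 2 * ((1 + t) `^ p + 1) `^ (2 / p - 1) * (1 + t) `^ (p - 1).
Let ddpsi (t : R) :=
  2 * (2 - p) * ((1 + t) `^ p + 1) `^ (2 / p - 2) * (1 + t) `^ (p - 1) ^+ 2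
  - 2 * (1 - p) * ((1 + t) `^ p + 1) `^ (2 / p - 1) * (1 + t) `^ (p - 2).

Lemma is_derive_powR_shift a (t : R) : `|t| < 1 ->
  is_derive t 1 (fun s : R => (1 + s) `^ a) (a * (1 + t) `^ (a - 1)).
Proof.
rewrite ltr_norml => t1.
pose arg (s : R) := 1 + s.
have arg' : is_derive t 1 arg 1.
  rewrite (_ : arg = cst 1 + id)//.
  by apply: is_derive_eq; rewrite add0r.
have pow' : is_derive (arg t) 1 (@powR R ^~ a) (a * arg t `^ (a - 1)).
  by apply: is_derive1_powR; rewrite /arg; lra.
by have := is_derive1_comp pow' arg'; rewrite mulr1.
Qed.

Lemma is_derive_powR_shift1 a (t : R) : `|t| < 1 ->
  is_derive t 1 (fun s : R => ((1 + s) `^ p + 1) `^ a)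
    (a * ((1 + t) `^ p + 1) `^ (a - 1) * (p * (1 + t) `^ (p - 1))).
Proof.
move=> t1; have base' := is_derive_powR_shift p t t1.
pose arg (s : R) := (1 + s) `^ p + 1.
have arg' : is_derive t 1 arg (p * (1 + t) `^ (p - 1)).
  rewrite (_ : arg = (fun s : R => (1 + s) `^ p) + cst 1)//.
  by apply: is_derive_eq; rewrite addr0.
have pow' : is_derive (arg t) 1 (@powR R ^~ a) (a * arg t `^ (a - 1)).
  by apply: is_derive1_powR; rewrite ltr_wpDl ?powR_ge0.
exact: is_derive1_comp pow' arg'.
Qed.

Lemma is_derive_psi (t : R) : `|t| < 1 -> is_derive t 1 psi (dpsi t).
Proof.
move=> t1; have psi' := is_derive_powR_shift1 (2 / p) t t1.
apply: is_derive_eq; rewrite /dpsi; field.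
by have p01' := p01; lra.
Qed.

Lemma is_derive_dpsi (t : R) : `|t| < 1 -> is_derive t 1 dpsi (ddpsi t).
Proof.
move=> t1; have G' := is_derive_powR_shift1 (2 / p - 1) t t1.
have b' := is_derive_powR_shift (p - 1) t t1.
apply: is_derive_eq; rewrite /ddpsi /GRing.scale/=.
have -> : 2 / p - 1 - 1 = 2 / p - 2 by ring.
have -> : p - 1 - 1 = p - 2 by ring.
field.
by have p01' := p01; lra.
Qed.

Lemma ddpsi0 : ddpsi 0 = p * 2 `^ (2 / p - 1).
Proof.
rewrite /ddpsi addr0 !powR1 expr1n !mulr1.
have -> : 2 `^ (2 / p - 1) = 2 * 2 `^ (2 / p - 2) :> R.
  have -> : 2 / p - 1 = 1 + (2 / p - 2) by ring.
  by rewrite powRD ?powRr1// pnatr_eq0 implybT.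
have -> : 1 + 1 = 2 :> R by [].
ring.
Qed.

Lemma continuous_ddpsi : {for 0, continuous ddpsi}.
Proof.
have cont (f : R -> R) (df : R) : is_derive (0 : R) 1 f df -> {for 0, continuous f}.
  by move=> [f' _]; apply: differentiable_continuous; exact/derivable1_diffP.
have n01 : `|0 : R| < 1 by rewrite normr0.
have cG a := cont _ _ (is_derive_powR_shift1 a 0 n01).
have cb a := cont _ _ (is_derive_powR_shift a 0 n01).
apply: cvgB; (apply: cvgM; [apply: cvgM; [exact: cvg_cst|exact: cG]|]).
  by apply: (@cvgM _ _ _ _ _ _ _ _ (cb _) (cb _)).
exact: cb.
Qed.

Lemma cone_ineq_second_difference (C : R) : cone_ineq p C ->
  forall h, 0 <= h < 1 -> psi h + psi (- h) - 2 * psi 0 <= C * h ^+ 2.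
Proof.
move=> coneC h h01; have p01' := p01.
have p0 : p != 0 by lra.
have inL (f : bool -> R) : f \in Lfun two_points p%:E.
  rewrite inE; apply/andP; split; rewrite inE//=.
  by rewrite /finite_norm Lnorm_two_points ltry.
pose y b : R := if b then h else 0.
have := coneC _ _ two_points (cst 1) y (inL _) (inL _).
move=> /(_ _ _)/wrap[]; [by apply: aeW => -[]/=; lra|by apply: aeW => -[]/=; lra|].
rewrite !sqr_Lnorm_two_points /= -!EFinM -!EFinD lee_fin addr0 subr0 normr1 normr0.
rewrite powR1 (powR0 p0) addr0.
rewrite !ger0_norm; [|lra..].
have -> : (h `^ p) `^ (2 / p) = h ^+ 2.
  by rewrite -powRrM mulrC divfK// powR_mulrn//; lra.
by rewrite /psi addr0 powR1 lerBlDl.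
Qed.

(** If [C] were smaller than [psi''(0)], then [psi''] would stay above the
    midpoint of the two near [0], and so would the second differences of [psi]
    divided by [h^2]. *)
Lemma cone_ineq_ge (C : R) : cone_ineq p C -> p * 2 `^ (2 / p - 1) <= C.
Proof.
move=> coneC; rewrite leNgt; apply/negP => ltC.
set D := p * _ in ltC.
have : \forall t \near (0 : R), (C + D) / 2 < ddpsi t.
  have := continuous_ddpsi; rewrite /prop_for/continuous_at ddpsi0.
  by move/cvgr_gt; apply; rewrite -/D; lra.
move=> /nbhs_ballP[r /= r0 ball_ddpsi].
pose r' := Num.min r 1.
have r'0 : 0 < r' by rewrite lt_min r0 ltr01.
have le1 (t : R) : `|t| < r' -> `|t| < 1 by rewrite lt_min => /andP[].
have r'1 : r' <= 1 by rewrite ge_min lexx orbT.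
have h01 : 0 <= r' / 2 < r' by lra.
have h1 : 0 <= r' / 2 < 1 by lra.
have := second_difference_ge _ _ _ _ r' ((C + D) / 2)
  (fun t tr => is_derive_psi t (le1 t tr)) (fun t tr => is_derive_dpsi t (le1 t tr)).
move=> /(_ _ _ h01)/wrap[].
  move=> t; rewrite lt_min => /andP[tr _]; apply/ltW/ball_ddpsi.
  by rewrite /ball/= sub0r normrN.
move=> le_psi; have psi_ge := le_trans le_psi (cone_ineq_second_difference C coneC _ h1).
have s0 : 0 < (r' / 2) ^+ 2 by rewrite exprn_gt0// divr_gt0.
by rewrite (ler_pM2r s0) in psi_ge; clear -ltC psi_ge; lra.
Qed.

End optimality.

Theorem corollary1p6 (R : realType) (p : R) (p0 : 0 < p) (p1 : p < 1) :
  cone_ineq p (p * 2 `^ (2 / p - 1)) /\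
  (forall C : R, cone_ineq p C -> p * 2 `^ (2 / p - 1) <= C).
Proof.
have p01 : 0 < p < 1 by rewrite p0.
split; first exact: cone_ineq_holds.
exact: cone_ineq_ge.
Qed.
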